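(* Let $n\ge2$ and $1<p<\infty$. Then $w(x)=|x'|^{\theta_1}|x|^{\theta_2}|x_n|^{\theta_3}$ is an $A_p$-weight on $\mathbb{R}^n$ if $(\theta_1,\theta_2,\theta_3)\in(\mathcal{A}\cup\mathcal{B})\cap(\mathcal{C}_p\cup\mathcal{D}_p)$.
   Context: Write $x=(x',x_n)\in\mathbb{R}^n$ with $x'=(x_1,\dots,x_{n-1})$. For $p>1$ define $$\mathcal{A}=\{(\theta_1,\theta_2,\theta_3):\theta_1>-(n-1),\ \theta_2\ge 0,\ \theta_3>-1\},$$ $$\mathcal{B}=\{(\theta_1,\theta_2,\theta_3):\theta_1>-(n-1),\ \theta_2<0,\ \theta_3>-1,\ \theta_1+\theta_2+\theta_3>-n\},$$ $$\mathcal{C}_p=\{(\theta_1,\theta_2,\theta_3):\theta_1<(n-1)(p-1),\ \theta_2\le 0,\ \theta_3<p-1\},$$ $$\mathcal{D}_p=\{(\theta_1,\theta_2,\theta_3):\theta_1<(n-1)(p-1),\ \theta_2>0,\ \theta_3<p-1,\ \theta_1+\theta_2+\theta_3<n(p-1)\}.$$ A weight $w$ is an $A_p$-weight ($1<p<\infty$) if there is a constant $C=C(n,p,w)>0$ such that for every ball $B\subset\mathbb{R}^n$ $$\frac1{|B|}\int_B w\,dx\left(\frac1{|B|}\int_B w^{-\frac1{p-1}}dx\right)^{p-1}\le C.$$ *)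

(* Defs.v *)
From HB Require Import structures.
From mathcomp Require Import all_boot all_order all_algebra.
From mathcomp Require Import all_classical all_reals all_analysis.
Import Order.TTheory GRing.Theory Num.Theory numFieldNormedType.Exports.

Set Implicit Arguments.
Unset Strict Implicit.
Unset Printing Implicit Defensive.

Local Open Scope classical_set_scope.
Local Open Scope ring_scope.

(* R^n as n-tuples, which carry the product sigma-algebra of the Borel sets. *)
Notation rvec R n := (n.-tuple (measurableTypeR R)).

Section nlebesgue.
Context (R : realType).

Definition cons_rvec n (x : measurableTypeR R * rvec R n) : rvec R n.+1 :=
  [tuple of x.1 :: x.2].

Lemma measurable_cons_rvec n : measurable_fun setT (@cons_rvec n).
Proof. exact: measurable_cons. Qed.

Section cons_measure.
Local Open Scope ereal_scope.
Variables (n : nat) (m : {sigma_finite_measure set (rvec R n) -> \bar R}).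

Definition cons_measure : set (rvec R n.+1) -> \bar R :=
  pushforward (@lebesgue_measure R \x m) (@cons_rvec n).

Let cons_measure0 : cons_measure set0 = 0.
Proof. by rewrite /cons_measure /pushforward preimage_set0 measure0. Qed.

Let cons_measure_ge0 A : 0 <= cons_measure A.
Proof. by rewrite /cons_measure /pushforward; exact: measure_ge0. Qed.

Let cons_measure_sigma_additive : semi_sigma_additive cons_measure.
Proof.
have mcons A : measurable A -> measurable (@cons_rvec n @^-1` A).
  by move=> mA; rewrite -[X in measurable X]setTI; exact: measurable_cons_rvec.
move=> F mF tF mUF; rewrite /cons_measure /pushforward preimage_bigcup.
apply: measure_semi_sigma_additive.
- by move=> i; exact: mcons.
- apply/trivIsetP => i j _ _ ij; rewrite -preimage_setI.
  by move/trivIsetP : tF => /(_ _ _ _ _ ij) ->//; rewrite preimage_set0.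
- by rewrite -preimage_bigcup; exact: mcons.
Qed.

HB.instance Definition _ := isMeasure.Build _ _ _ cons_measure
  cons_measure0 cons_measure_ge0 cons_measure_sigma_additive.

Lemma cons_measure_sigma_finite : sigma_finite setT cons_measure.
Proof.
pose uncons (x : rvec R n.+1) : measurableTypeR R * rvec R n :=
  (tnth x ord0, [tuple of behead x]).
have muncons : measurable_fun setT uncons.
  by apply/measurable_fun_pair; [exact: measurable_tnth|exact: measurable_behead].
have consK : uncons \o @cons_rvec n = id.
  by apply/funext => -[a t]; congr pair; apply/val_inj.
have /sigma_finiteP[F [TF ndF Foo]] := sigma_finiteT (@lebesgue_measure R).
have /sigma_finiteP[G [TG ndG Goo]] := sigma_finiteT m.
exists (fun k => uncons @^-1` (F k `*` G k)).
  apply/esym; rewrite -subTset => x _.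
  have [i _ Fi] : (\bigcup_k F k) (uncons x).1 by rewrite -TF.
  have [j _ Gj] : (\bigcup_k G k) (uncons x).2 by rewrite -TG.
  exists (maxn i j) => //; split.
  - by move: Fi; exact/subsetPset/ndF/leq_maxl.
  - by move: Gj; exact/subsetPset/ndG/leq_maxr.
move=> k; have [mF Foo'] := Foo k; have [mG Goo'] := Goo k; split.
  by rewrite -[X in measurable X]setTI; apply: muncons => //; exact: measurableX.
rewrite /cons_measure /pushforward -comp_preimage consK.
by rewrite preimage_id product_measure1E// lte_mul_pinfty// ge0_fin_numE.
Qed.

HB.instance Definition _ := Measure_isSigmaFinite.Build _ _ _ cons_measure
  cons_measure_sigma_finite.

End cons_measure.

(* n-dimensional Lebesgue measure: the n-fold product of lebesgue_measure,
   transported to tuples. *)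
Fixpoint nlebesgue n : {sigma_finite_measure set (rvec R n) -> \bar R} :=
  if n is k.+1 then cons_measure (nlebesgue k)
  else dirac ([tuple] : rvec R 0).

Local Open Scope ereal_scope.

Lemma nlebesgue_box n (A : 'I_n -> set R) :
  (forall i, measurable (A i)) ->
  nlebesgue n [set x | forall i, A i (tnth x i)] =
  \prod_(i < n) lebesgue_measure (A i).
Proof.
have mbox k (B : 'I_k -> set R) : (forall i, measurable (B i)) ->
    measurable [set x : rvec R k | forall i, B i (tnth x i)].
  move=> mB; rewrite [X in measurable X](_ : _ =
      \bigcap_(i in [set: 'I_k]) ((fun x : rvec R k => tnth x i) @^-1` B i)).
    apply: fin_bigcap_measurable => // i _; rewrite -[X in measurable X]setTI.
    by apply: measurable_tnth => //; exact: mB.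
  by apply/seteqP; split => x /= h i; [move=> _|]; exact: h.
elim: n A => [|n IH] A mA.
  rewrite big_ord0 /= /dirac indicE mem_set//= => -[].
  by case.
rewrite big_ord_recl -IH//.
pose B := [set t : rvec R n | forall i, A (lift ord0 i) (tnth t i)].
have mB : measurable B by exact: (mbox _ (fun i => A (lift ord0 i))).
rewrite -(product_measure1E (@lebesgue_measure R) (nlebesgue n) (mA ord0) mB).
rewrite -[LHS]/((@lebesgue_measure R \x nlebesgue n)
  (@cons_rvec n @^-1` [set x | forall i, A i (tnth x i)])).
congr (product_measure1 _ _ _); apply/seteqP; split => -[a t] /=.
  move=> h; split; first exact: (h ord0).
  by move=> i; have := h (lift ord0 i); rewrite tnthS.
move=> [h0 h] i; case: (unliftP ord0 i) => [j|] ->//.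
by rewrite tnthS.
Qed.

End nlebesgue.

Section weights.
Context (R : realType).

Definition enorm m (x : rvec R m) : R := Num.sqrt (\sum_(i < m) tnth x i ^+ 2).

(* x' = (x_1, ..., x_(n-1)) *)
Definition rprefix n (x : rvec R n) : rvec R n.-1 :=
  [tuple tnth x (widen_ord (leq_pred n) i) | i < n.-1].

(* x_n; the default value of last is only reached for n = 0 *)
Definition rlast n (x : rvec R n) : R := last 0 x.

Definition eball n (c : rvec R n) (r : R) : set (rvec R n) :=
  [set x | enorm ([tuple tnth x i - tnth c i | i < n] : rvec R n) < r].

Definition average n (B : set (rvec R n)) (f : rvec R n -> R) : \bar R :=
  ((nlebesgue R n B)^-1 * \int[nlebesgue R n]_(x in B) (f x)%:E)%E.

(* A nonnegative, locally integrable function that is positive a.e. Without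
   positivity the convention 0 `^ (- a) = 0 would make the dual average below
   meaningless. *)
Definition is_weight n (w : rvec R n -> R) : Prop :=
  [/\ forall x, 0 <= w x,
      {ae nlebesgue R n, forall x, 0 < w x} &
      forall c r, 0 < r -> (nlebesgue R n).-integrable (eball c r) (EFin \o w)].

Definition Ap_weight n (p : R) (w : rvec R n -> R) : Prop :=
  is_weight w /\
  exists C : R, 0 < C /\
    forall (c : rvec R n) (r : R), 0 < r ->
      (average (eball c r) w *
       poweR (average (eball c r) (fun x => (w x `^ (- (p - 1)^-1))%R)) (p - 1)
       <= C%:E)%E.

(* The value 0 `^ t = 0 for t < 0 only matters on the null set where x' = 0 or
   x_n = 0. *)
Definition aniso_weight n (t1 t2 t3 : R) (x : rvec R n) : R :=
  enorm (rprefix x) `^ t1 * enorm x `^ t2 * `|rlast x| `^ t3.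

Definition setA (n : nat) : set (R * R * R) :=
  [set t | let: (t1, t2, t3) := t in
    [/\ - (n%:R - 1) < t1, 0 <= t2 & -1 < t3]].

Definition setB (n : nat) : set (R * R * R) :=
  [set t | let: (t1, t2, t3) := t in
    [/\ - (n%:R - 1) < t1, t2 < 0, -1 < t3 & - n%:R < t1 + t2 + t3]].

Definition setCp (n : nat) (p : R) : set (R * R * R) :=
  [set t | let: (t1, t2, t3) := t in
    [/\ t1 < (n%:R - 1) * (p - 1), t2 <= 0 & t3 < p - 1]].

Definition setDp (n : nat) (p : R) : set (R * R * R) :=
  [set t | let: (t1, t2, t3) := t in
    [/\ t1 < (n%:R - 1) * (p - 1), 0 < t2, t3 < p - 1 &
        t1 + t2 + t3 < n%:R * (p - 1)]].

End weights.

(* Main.v *)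
Require Import Defs.
From mathcomp Require Import all_boot all_order all_algebra.
From mathcomp Require Import all_classical all_reals all_analysis.
From mathcomp Require Import measurable_realfun ring lra.
Import Order.TTheory GRing.Theory Num.Theory numFieldNormedType.Exports.

Local Open Scope classical_set_scope.
Local Open Scope ring_scope.

(* The hypothesis says that both (t1, t2, t3) and the dual exponents
   - (t1, t2, t3) / (p - 1) satisfy a > - (n - 1), c > -1, a + b + c > - n.
   For such (a, b, c) the average of |x'|^a |x|^b |x_n|^c over the ball B(y, r)
   is at most a constant times
   M = max(|y'|, r)^a max(|y|, r)^b max(|y_n|, r)^c,
   and the values of M for the two triples cancel in the A_p product.

   The bound on averages is reduced to one-dimensional integrals: on B(y, r) and
   off the coordinate hyperplanes, the weight is at most a constant times
   M * prod_i (1 + 1_{|x_i| <= r} (|x_i| / r)^(- d)) for some d < 1. Each of the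
   factors |x'|, |x|, |x_n| is either comparable to its value at y, or of size
   O(r), and then its negative powers are split over the coordinates. When b < 0
   and |y| < 2 r, use |x|^b <= |x'|^(b l) |x_n|^(b (1 - l)) with l in [0, 1] such
   that a + b l > - (n - 1) and c + b (1 - l) > -1; such an l exists precisely
   because a + b + c > - n. *)

(** * Real powers and the pointwise bound for a product of three powers *)

Section power_inequalities.
Context {R : realType}.
Implicit Types a b c d r x y z N S U V : R.

Lemma ler_npowR a x y : a <= 0 -> 0 < x -> x <= y -> y `^ a <= x `^ a.
Proof.
move=> a0 x0 xy; have y0 : 0 < y by exact: lt_le_trans xy.
rewrite -[a]opprK 2!(powRN _ (- a)) lef_pV2 ?posrE ?powR_gt0//.
by apply: ge0_ler_powR; rewrite ?nnegrE ?oppr_ge0 ?(ltW x0) ?(ltW y0).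
Qed.

Lemma powR_comparable b x y : 0 < x -> x <= 2 * y -> y <= 2 * x ->
  x `^ b <= 2 `^ `|b| * y `^ b.
Proof.
move=> x0 xy yx; have y0 : 0 < y by lra.
have [b0|b0] := leP 0 b.
  rewrite ger0_norm// -powRM; [|lra..].
  by apply: ge0_ler_powR; rewrite ?nnegrE; lra.
rewrite ltr0_norm// powRN -powR_inv1// powRAC -powRM ?powR_ge0 ?(ltW y0)//.
rewrite powR_inv1//.
by apply: ler_npowR; [lra|rewrite mulr_gt0// invr_gt0|lra].
Qed.

(** The right side of the hypothesis is at most 4 max(U, r)^2. In the application y and U are norms
    of a point of a ball and of its centre, and r is the radius. *)
Lemma le_double_max r y U : 0 < r -> 0 < y -> 0 <= U ->
  y ^+ 2 <= 2 * U ^+ 2 + 2 * r ^+ 2 -> y <= 2 * Num.max U r.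
Proof.
move=> r0 y0 U0 yU.
have UM : U <= Num.max U r by rewrite le_max lexx.
have rM : r <= Num.max U r by rewrite le_max lexx orbT.
by rewrite -(@ler_pXn2r _ 2) ?nnegrE//; nra.
Qed.

(** Here 2 r^2 <= U^2 / 2, which is absorbed by the left side. *)
Lemma le_double r y U : 0 < r -> 0 < y -> 2 * r <= U ->
  U ^+ 2 <= 2 * y ^+ 2 + 2 * r ^+ 2 -> U <= 2 * y.
Proof. by move=> r0 y0 rU Uy; rewrite -(@ler_pXn2r _ 2) ?nnegrE//; nra. Qed.

(** The summand 1 keeps the factor at least 1, so that spare factors may be multiplied into an upper
    bound. For d < 1 the singular term, cut off at |x| = r, has an integral of order r. *)
Definition singular_factor d r x : R :=
  1 + (if `|x| <= r then (`|x| / r) `^ (- d) else 0).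

Lemma singular_factor_ge1 d r x : 1 <= singular_factor d r x.
Proof. by rewrite /singular_factor; case: ifP => _; rewrite ?addr0// lerDl powR_ge0. Qed.

(** If |x| <= r, the base is at most 1 and lowering the exponent to - d enlarges the power;
    otherwise the power is at most 1. *)
Lemma powR_le_singular_factor d a r x : 0 < r -> x != 0 -> - d <= a -> a <= 0 ->
  (`|x| / r) `^ a <= singular_factor d r x.
Proof.
move=> r0 x0 da a0; have q0 : 0 < `|x| / r by rewrite divr_gt0// normr_gt0.
rewrite /singular_factor; case: ifPn => [xr|]; last rewrite -ltNge => rx.
  rewrite -[leLHS]add0r lerD//; apply: ger_powR => //.
  by rewrite q0/= ler_pdivrMr// mul1r.
rewrite addr0; apply: (@le_trans _ _ (1 `^ a)); last by rewrite powR1.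
by apply: ler_npowR => //; rewrite ler_pdivlMr// mul1r ltW.
Qed.

Lemma prod_singular_factor_ge1 d r m (x : 'I_m -> R) :
  1 <= \prod_(i < m) singular_factor d r (x i).
Proof.
elim/big_ind : _ => //; last by move=> i _; exact: singular_factor_ge1.
by move=> u v u1 v1; rewrite -[1]mulr1 ler_pM.
Qed.

(** In the application the x_i are the coordinates of a vector of norm y. If a >= 0 or U >= 2 r,
    then max(U, r)^a alone controls y^a, and the product is at least 1. Otherwise max(U, r) is
    within a factor 2 of r, and (y / r)^a is split into m equal powers, the i-th of which is bounded
    through |x_i| <= y. *)
Lemma norm_powR_le d a r m (x : 'I_m -> R) y U :
  - (m%:R * d) <= a -> 0 < r -> 0 <= U ->
  (forall i, x i != 0) -> (forall i, `|x i| <= y) -> 0 < y ->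
  y ^+ 2 <= 2 * U ^+ 2 + 2 * r ^+ 2 -> U ^+ 2 <= 2 * y ^+ 2 + 2 * r ^+ 2 ->
  y `^ a <= 2 `^ `|a| * Num.max U r `^ a * \prod_(i < m) singular_factor d r (x i).
Proof.
move=> da r0 U0 x0 xy y0 yU Uy.
have h1 := prod_singular_factor_ge1 d r _ x.
have UM : U <= Num.max U r by rewrite le_max lexx.
have rM : r <= Num.max U r by rewrite le_max lexx orbT.
have yM : y <= 2 * Num.max U r by exact: le_double_max.
have M0 : 0 < Num.max U r by lra.
have [a0|a0] := leP 0 a.
  apply: (@le_trans _ _ (2 `^ `|a| * Num.max U r `^ a)); last first.
    by rewrite ler_peMr// mulr_ge0 ?powR_ge0.
  rewrite ger0_norm// -powRM; [|lra..].
  by apply: ge0_ler_powR; rewrite ?nnegrE; lra.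
have [Ur|Ur] := leP (2 * r) U.
  have Uy2 : U <= 2 * y by exact: (@le_double r).
  have -> : Num.max U r = U by apply/max_idPl; lra.
  apply: (@le_trans _ _ (2 `^ `|a| * U `^ a)); last first.
    by rewrite ler_peMr// mulr_ge0 ?powR_ge0.
  apply: powR_comparable => //.
  by move: yM; have -> : Num.max U r = U by apply/max_idPl; lra.
have Mr : Num.max U r <= 2 * r by rewrite ge_max; apply/andP; split; lra.
have -> : y = r * (y / r) by field; lra.
rewrite powRM ?(ltW r0) ?divr_ge0 ?(ltW y0) ?(ltW r0)//.
apply: ler_pM; rewrite ?powR_ge0//.
  by apply: powR_comparable => //; lra.
(* For m = 0 the lower bound on a reads 0 <= a, against a < 0. *)
have m0 : (0 < m)%N.
  by case: m da {x x0 xy h1} => // da; move: da a0; rewrite mul0r oppr0; lra.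
have mR0 : 0 < m%:R :> R by rewrite ltr0n.
have -> : (y / r) `^ a = \prod_(i < m) (y / r) `^ (a / m%:R).
  rewrite prodr_const card_ord -powR_mulrn ?powR_ge0// -powRrM.
  by congr (_ `^ _); field; rewrite gt_eqF.
have am0 : a / m%:R <= 0 by rewrite pmulr_lle0 ?invr_gt0// ltW.
apply: ler_prod => i _; rewrite powR_ge0/=.
apply: (@le_trans _ _ ((`|x i| / r) `^ (a / m%:R))).
  apply: ler_npowR => //; first by rewrite divr_gt0// normr_gt0.
  by rewrite ler_pM2r ?invr_gt0.
apply: powR_le_singular_factor => //.
by rewrite ler_pdivlMr// mulNr mulrC.
Qed.

(** Let P = a + m and Q = c + 1 be the margins; the third hypothesis says P + Q + b > 0. Sharing b
    in proportion to the margins, l = P / (P + Q), multiplies both of them by the positive number 1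
    + b / (P + Q). *)
Lemma splitting_exponent m a b c :
  - m < a -> -1 < c -> - (m + 1) < a + b + c ->
  exists2 l : R, 0 <= l <= 1 & - m < a + b * l /\ -1 < c + b * (1 - l).
Proof.
move=> am c1 abc; pose P := a + m; pose Q := c + 1.
have P0 : 0 < P by rewrite /P; lra.
have Q0 : 0 < Q by rewrite /Q; lra.
have PQ0 : 0 < P + Q by exact: addr_gt0.
have t1 : 0 < 1 + b / (P + Q).
  have -> : 1 + b / (P + Q) = (P + Q + b) / (P + Q) by field; lra.
  by apply: divr_gt0 => //; rewrite /P /Q; lra.
exists (P / (P + Q)).
  rewrite divr_ge0 ?(ltW P0) ?(ltW PQ0)//=.
  by rewrite ler_pdivrMr// mul1r lerDl (ltW Q0).
split.
  have -> : a + b * (P / (P + Q)) = - m + P * (1 + b / (P + Q)).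
    by rewrite /P; field; lra.
  by rewrite ltrDl mulr_gt0.
have -> : c + b * (1 - P / (P + Q)) = -1 + Q * (1 + b / (P + Q)).
  by rewrite /P /Q; field; rewrite /P /Q in PQ0; lra.
by rewrite ltrDl mulr_gt0.
Qed.

(** Gives a common d for finitely many exponents, so that one [singular_factor] serves all cases. *)
Lemma subcritical_order (s : seq R) : (forall x, x \in s -> -1 < x) ->
  exists2 d : R, d < 1 & forall x, x \in s -> - d <= x.
Proof.
elim: s => [_|x s IH h]; first by exists 0; rewrite ?ltr01.
have [|d d1 hd] := IH; first by move=> y ys; apply: h; rewrite in_cons ys orbT.
have x1 := h x (mem_head _ _).
exists (Num.max d (- x)); first by rewrite gt_max d1/=; lra.
move=> y; rewrite in_cons => /predU1P[->|/hd dy].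
  by rewrite -[leRHS]opprK lerN2 le_max lexx orbT.
by apply: le_trans dy; rewrite lerN2 le_max lexx.
Qed.

(** Here u, v, s stand for |x'|, |x_n|, |x| and U, V, S for the same norms of the centre; the
    quadratic hypotheses are what membership in the ball provides. The constant is a sum because the
    cases with and without splitting of b have different constants. *)
Lemma triple_powR_le m a b c :
  - m.+1%:R < a -> -1 < c -> - (m.+1%:R + 1) < a + b + c ->
  exists K d : R, [/\ 0 < K, d < 1 &
    forall r (x : 'I_m.+1 -> R) z u v s U V S,
    0 < r -> (forall i, x i != 0) -> z != 0 -> (forall i, `|x i| <= u) ->
    0 < u -> v = `|z| -> u <= s -> v <= s -> 0 <= U -> 0 <= V -> U <= S -> V <= S ->
    u ^+ 2 <= 2 * U ^+ 2 + 2 * r ^+ 2 -> U ^+ 2 <= 2 * u ^+ 2 + 2 * r ^+ 2 ->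
    v ^+ 2 <= 2 * V ^+ 2 + 2 * r ^+ 2 -> V ^+ 2 <= 2 * v ^+ 2 + 2 * r ^+ 2 ->
    s ^+ 2 <= 2 * S ^+ 2 + 2 * r ^+ 2 -> S ^+ 2 <= 2 * s ^+ 2 + 2 * r ^+ 2 ->
    u `^ a * s `^ b * v `^ c <=
    K * (Num.max U r `^ a * Num.max S r `^ b * Num.max V r `^ c) *
    ((\prod_(i < m.+1) singular_factor d r (x i)) * singular_factor d r z)].
Proof.
move=> am c1 abc.
have m0 : 0 < m.+1%:R :> R by rewrite ltr0n.
have [l /andP[l0 l1] [aml cl]] := splitting_exponent _ _ _ _ am c1 abc.
(* These are the exponents per coordinate, before and after b is shared out; powers of |x'| are
   divided by its number of coordinates. *)
have [|d d1 hd] := subcritical_order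
    [:: a / m.+1%:R; c; (a + b * l) / m.+1%:R; c + b * (1 - l)].
  move=> x; rewrite !inE => /or4P[] /eqP -> //.
    by rewrite ltr_pdivlMr// mulN1r.
  by rewrite ltr_pdivlMr// mulN1r.
have da : - (m.+1%:R * d) <= a.
  have := hd (a / m.+1%:R); rewrite !inE eqxx/= => /(_ isT).
  by rewrite ler_pdivlMr// mulNr mulrC.
have dc : - (1%:R * d) <= c.
  by have := hd c; rewrite !inE eqxx orbT mul1r; exact.
have dal : - (m.+1%:R * d) <= a + b * l.
  have := hd ((a + b * l) / m.+1%:R); rewrite !inE eqxx/= !orbT => /(_ isT).
  by rewrite ler_pdivlMr// mulNr mulrC.
have dcl : - (1%:R * d) <= c + b * (1 - l).
  by have := hd (c + b * (1 - l)); rewrite !inE eqxx !orbT mul1r; exact.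
pose K1 := 2 `^ `|a| * 2 `^ `|b| * 2 `^ `|c|.
pose K2 := 2 `^ `|a + b * l| * 2 `^ `|b| * 2 `^ `|c + b * (1 - l)|.
have p2 e : 0 < 2 `^ e :> R by rewrite powR_gt0.
have K10 : 0 < K1 by rewrite /K1 !mulr_gt0.
have K20 : 0 < K2 by rewrite /K2 !mulr_gt0.
exists (K1 + K2), d; split => //; first exact: addr_gt0.
move=> r x z u v s U V S r0 x0 z0 xu u0 vz us vs U0 V0 US VS uU Uu vV Vv sS Ss.
have v0 : 0 < v by rewrite vz normr_gt0.
have s0 : 0 < s by exact: lt_le_trans us.
set Px := \prod_(i < m.+1) _; set h := singular_factor d r z.
have Px1 : 1 <= Px by exact: prod_singular_factor_ge1.
have h1 : 1 <= h by exact: singular_factor_ge1.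
have Px0 : 0 <= Px by exact: le_trans Px1.
have h0 : 0 <= h by exact: le_trans h1.
set MU := Num.max U r; set MV := Num.max V r; set MS := Num.max S r.
have ua e : - (m.+1%:R * d) <= e -> u `^ e <= 2 `^ `|e| * MU `^ e * Px.
  by move=> de; exact: norm_powR_le.
have va e : - (1%:R * d) <= e -> v `^ e <= 2 `^ `|e| * MV `^ e * h.
  move=> de; have := @norm_powR_le d e r 1 (fun=> z) v V.
  by rewrite big_ord1; apply => //; move=> _; rewrite vz.
have M0 W : 0 < Num.max W r by rewrite lt_max r0 orbT.
have rMU : r <= MU by rewrite /MU le_max lexx orbT.
have rMV : r <= MV by rewrite /MV le_max lexx orbT.
have rMS : r <= MS by rewrite /MS le_max lexx orbT.
have r2 : r <= 2 * r by rewrite ler_peMl ?ler1n// ltW.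
have S0 : 0 <= S by exact: le_trans US.
have sMS : s <= 2 * MS by exact: le_double_max.
set RHS := leRHS.
have near_far K' : 0 <= K' -> K' <= K1 + K2 ->
  u `^ a * s `^ b * v `^ c <= K' * (MU `^ a * MS `^ b * MV `^ c) * (Px * h) ->
  u `^ a * s `^ b * v `^ c <= RHS.
  move=> K'0 K'K /le_trans; apply; rewrite /RHS.
  apply: ler_wpM2r; first by exact: mulr_ge0.
  by apply: ler_wpM2r => //; rewrite !mulr_ge0 ?powR_ge0.
(* If s^b is controlled by its value at the centre, u^a and v^c are bounded separately. This settles
   b >= 0 and S >= 2 r. *)
have sfar : s `^ b <= 2 `^ `|b| * MS `^ b -> u `^ a * s `^ b * v `^ c <= RHS.
  move=> sb; apply: (near_far K1); [exact: ltW|by rewrite lerDl ltW|].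
  apply: (@le_trans _ _ ((2 `^ `|a| * MU `^ a * Px) * (2 `^ `|b| * MS `^ b) * (2 `^ `|c| * MV `^ c * h))).
    apply: ler_pM; rewrite ?mulr_ge0 ?powR_ge0 ?va//.
    by apply: ler_pM; rewrite ?mulr_ge0 ?powR_ge0 ?ua.
  by rewrite le_eqVlt; apply/orP; left; apply/eqP; rewrite /K1; ring.
have [b0|b0] := leP 0 b.
  apply: sfar; rewrite ger0_norm// -powRM// ?(ltW (M0 _))//.
  by apply: ge0_ler_powR; rewrite // nnegrE ?mulr_ge0 ?(ltW s0) ?(ltW (M0 _)).
have [Sr|Sr] := leP (2 * r) S.
  apply: sfar; apply: powR_comparable => //.
  rewrite /MS ge_max (le_double _ _ _ r0 s0 Sr Ss)/=.
  apply: le_trans (le_double _ _ _ r0 s0 Sr Ss); exact: le_trans r2 Sr.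
apply: (near_far K2); [exact: ltW|by rewrite lerDr ltW|].
have powRD2 y : 0 < y -> y `^ b = y `^ (b * l) * y `^ (b * (1 - l)).
  move=> y0; rewrite -powRD; last by rewrite (gt_eqF y0) implybT.
  by congr (_ `^ _); ring.
have powRD' y e f : 0 < y -> y `^ (e + f) = y `^ e * y `^ f.
  by move=> y0; rewrite powRD// (gt_eqF y0) implybT.
have bl : b * l <= 0 by rewrite mulr_le0_ge0// ltW.
have bl' : b * (1 - l) <= 0 by rewrite mulr_le0_ge0 ?subr_ge0// ltW.
(* Now b < 0 and S < 2 r. The exponents b l and b (1 - l) are nonpositive and u, v <= s, so the two
   parts of s^b are passed to u and v. *)
apply: (@le_trans _ _ (u `^ (a + b * l) * v `^ (c + b * (1 - l)))).
  rewrite !powRD'// (powRD2 s)//.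
  rewrite [leRHS](_ : _ = u `^ a * (u `^ (b * l) * v `^ (b * (1 - l))) * v `^ c); last by ring.
  do 2 (apply: ler_pM; rewrite ?mulr_ge0 ?powR_ge0//).
  by apply: ler_pM; rewrite ?powR_ge0//; apply: ler_npowR.
apply: (@le_trans _ _ ((2 `^ `|a + b * l| * MU `^ (a + b * l) * Px) *
    (2 `^ `|c + b * (1 - l)| * MV `^ (c + b * (1 - l)) * h))).
  by apply: ler_pM; rewrite ?powR_ge0 ?ua ?va.
rewrite !powRD' ?M0// [leLHS](_ : _ = (2 `^ `|a + b * l| * 2 `^ `|c + b * (1 - l)| *
   MU `^ a * MV `^ c * Px * h) * (MU `^ (b * l) * MV `^ (b * (1 - l)))); last by ring.
rewrite [leRHS](_ : _ = (2 `^ `|a + b * l| * 2 `^ `|c + b * (1 - l)| *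
   MU `^ a * MV `^ c * Px * h) * (2 `^ `|b| * MS `^ b)); last by rewrite /K2; ring.
apply: ler_wpM2l; first by rewrite !mulr_ge0 ?powR_ge0.
(* The powers of [MU] and [MV] recombine to at most r^b, as both maxima are at least r; and r^b is
   comparable to [MS]^b, as r <= [MS] <= 2 r. *)
apply: (@le_trans _ _ (r `^ b)).
  by rewrite (powRD2 r)//; apply: ler_pM; rewrite ?powR_ge0//; apply: ler_npowR.
apply: powR_comparable => //; last by rewrite /MS ge_max (ltW Sr).
by rewrite (le_trans rMS)// ler_peMl ?ler1n// (ltW (M0 _)).
Qed.

End power_inequalities.

(** * Integrals of the one-dimensional singular factor *)

Section singular_integral.
Context {R : realType}.
Notation mu := (@lebesgue_measure R).
Variables (d r : R).
Hypotheses (d1 : d < 1) (r0 : 0 < r).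

Let f (t : R) := (`|t| / r) `^ (- d).

Lemma continuous_norm_powR (t : R) : t != 0 -> {for t, continuous f}.
Proof.
move=> t0; rewrite (_ : f = (fun x : R => x `^ (- d)) \o (fun t : R => `|t| / r))//.
apply: continuous_comp.
  by apply: cvgM; [exact: norm_continuous|exact: cvg_cst].
apply: differentiable_continuous; apply/derivable1_diffP.
by apply: derivable_powR; rewrite in_itv/= andbT divr_gt0 ?normr_gt0.
Qed.

Lemma measurable_norm_powR D : measurable_fun D f.
Proof.
apply: measurable_funTS.
apply: (measurableT_comp (measurable_powR (- d))).
by apply: measurable_funM => //; exact: measurableT_comp.
Qed.

(** The antiderivative F(t) = r^d t^(1 - d) / (1 - d) has F(r) = r / (1 - d) and F(a) >= 0, so the
    bound is uniform in a. *)
Lemma integral_powR_annulus (a : R) : 0 < a -> a < r ->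
  (\int[mu]_(t in `[a, r]) (f t)%:E <= (r / (1 - d))%R%:E)%E.
Proof.
move=> a0 ar; pose k : R := r^-1 `^ (- d).
have d10 : 0 < 1 - d by rewrite subr_gt0.
pose F (t : R) := k / (1 - d) * t `^ (1 - d).
have dF (x : R) : 0 < x -> is_derive x 1 F (f x).
  move=> x0; have -> : f x = (k / (1 - d)) *: ((1 - d) * x `^ (1 - d - 1)).
    rewrite /f gtr0_norm// powRM ?(ltW x0) ?invr_ge0 ?(ltW r0)//.
    have -> : 1 - d - 1 = - d by ring.
    by rewrite /k /GRing.scale/=; field; lra.
  by apply: is_deriveZ; exact: is_derive1_powR.
have cF (x : R) : 0 < x -> {for x, continuous F}.
  move=> /dF dFx; apply: differentiable_continuous; apply/derivable1_diffP.
  exact: ex_derive.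
rewrite (@continuous_FTC2 _ _ F)//.
- rewrite -EFinB lee_fin.
  have -> : r / (1 - d) = F r.
    rewrite /F powRD; last by rewrite (gt_eqF r0) implybT.
    rewrite powRr1 ?(ltW r0)//.
    have kr : k * r `^ (- d) = 1.
      by rewrite -powRM ?invr_ge0 ?(ltW r0)// mulVf ?(gt_eqF r0)// powR1.
    transitivity (k * r `^ (- d) * (r / (1 - d))); first by rewrite kr mul1r.
    by field; lra.
  by rewrite gerBl mulr_ge0 ?powR_ge0// divr_ge0 ?powR_ge0 ?(ltW d10).
- apply: continuous_in_subspaceT => x /[!inE]/=; rewrite in_itv/= => /andP[ax _].
  by apply: continuous_norm_powR; rewrite gt_eqF// (lt_le_trans a0).
- split.
  + move=> x; rewrite in_itv/= => /andP[ax _].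
    by apply: ex_derive; apply: dF; exact: lt_trans ax.
  + exact: cvg_at_right_filter (cF _ a0).
  + exact: cvg_at_left_filter (cF _ r0).
- move=> x; rewrite in_itv/= => /andP[ax _].
  by rewrite derive1E; apply: derive_val; apply: dF; exact: lt_trans ax.
Qed.

(** Monotone convergence along the sets a_k <= |t| <= r, which avoid the singularity; they exhaust
    the interval up to the null set {0}. *)
Lemma integral_powR_symmetric :
  (\int[mu]_(t in `[(- r)%R, r]) (f t)%:E <= (2 * r / (1 - d))%R%:E)%E.
Proof.
(* The shift by 2 gives a_k < r already for k = 0. *)
pose a k := r / k.+2%:R.
have a0 k : 0 < a k by rewrite divr_gt0// ltr0n.
have ar k : a k < r by rewrite ltr_pdivrMr ?ltr0n// ltr_pMr// ltr1n.
pose D k : set R := `[(- r), (- a k)%R] `|` `[a k, r].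
have mf A : measurable_fun A (EFin \o f).
  by apply/measurable_EFinP; exact: measurable_norm_powR.
have f0 t : (0 <= (EFin \o f) t)%E by rewrite lee_fin powR_ge0.
have mD k : measurable (D k) by exact: measurableU.
have DE k : D k = [set t | a k <= `|t| <= r].
  apply/seteqP; split => t; rewrite /D/= !in_itv/=; have := a0 k; have := ar k.
    move=> ak0 akr [] /andP[h1 h2].
      by rewrite ler0_norm; [apply/andP; split; lra|lra].
    by rewrite ger0_norm; [apply/andP; split; lra|lra].
  move=> ak0 akr /andP[]; have [t0|t0] := lerP 0 t.
    by rewrite ger0_norm// => h1 h2; right; rewrite h1.
  by rewrite ltr0_norm// => h1 h2; left; apply/andP; split; lra.
have Dbound k : (\int[mu]_(t in D k) (f t)%:E <= (2 * r / (1 - d))%R%:E)%E.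
  rewrite ge0_integral_setU//=; last 3 first.
    exact: mf.
    by move=> t _; exact: f0.
    apply/disj_setPLR => t /=; rewrite !in_itv/= => /andP[_ ta] /andP[at_ _].
    by have := a0 k; lra.
  rewrite (@integration_by_substitution_oppr _ f (a k) r); [|exact: ltW|]; last first.
    apply: continuous_in_subspaceT => x /[!inE]/=; rewrite in_itv/= => /andP[_ xa].
    by apply: continuous_norm_powR; rewrite lt_eqF// (le_lt_trans xa)// oppr_lt0.
  have -> : (2 * r / (1 - d))%R%:E = ((r / (1 - d))%R%:E + (r / (1 - d))%R%:E)%E.
    by rewrite -EFinD; congr EFin; field; rewrite subr_eq0 gt_eqF.
  apply: leeD; last exact: integral_powR_annulus.
  under eq_integral do rewrite /= /f normrN.
  exact: integral_powR_annulus.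
have ndD : nondecreasing_seq D.
  move=> i j ij; rewrite subsetEset !DE => t /= /andP[it ->]; rewrite andbT.
  apply: le_trans it; rewrite ler_pM2l// lef_pV2 ?posrE ?ltr0n// ler_nat.
  by rewrite !ltnS.
have UD : \bigcup_k D k = `[(- r)%R, r] `\ 0.
  apply/seteqP; split => t.
    move=> [i _]; rewrite DE/= in_itv/= -ler_norml => /andP[h ->]; split => //.
    by apply/eqP; rewrite -normr_gt0 (lt_le_trans _ h).
  rewrite /= in_itv/= -ler_norml => -[tr /eqP t0].
  (* Any k with r / |t| <= k + 2 will do. *)
  exists (Num.truncn (r / `|t|)) => //; rewrite DE/= tr andbT /a.
  rewrite ler_pdivrMr ?ltr0n// mulrC -ler_pdivrMr ?normr_gt0//.
  have := truncnS_gt (r / `|t|).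
  by move=> /ltW/le_trans; apply; rewrite ler_nat.
rewrite [leLHS](_ : _ = (\int[mu]_(t in \bigcup_k D k) (EFin \o f) t)%E); last first.
  by rewrite UD; apply: ge0_negligible_integral => //;
    [exact: mf|move=> t _; exact: f0|exact: lebesgue_measure_set1].
have cD := @ge0_nondecreasing_set_cvg_integral _ (measurableTypeR R) R D
  (EFin \o f) mu ndD mD (fun i => mf _) (fun i x _ => f0 x).
rewrite -(cvg_lim _ cD)//; apply: lime_le; first by apply/cvg_ex; eexists; exact: cD.
exact: nearW.
Qed.

Lemma measurable_singular_factor D : measurable_fun D (singular_factor d r).
Proof.
apply: measurable_funTS; apply: measurable_funD => //.
apply: measurable_fun_ifT => //; last exact: measurable_norm_powR.
apply: (measurable_fun_ler (f := fun x : R => `|x|) (g := cst r)) => //.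
Qed.

(** The summand 1 contributes the length 2 r of the interval. The singular term lives on |t| <= r,
    so its integral is at most the one over [- r, r], wherever the centre c is. *)
Lemma integral_singular_factor (c : R) :
  (\int[mu]_t (singular_factor d r t * \1_(`]c - r, c + r[) t)%R%:E <=
   ((2 + 2 / (1 - d)) * r)%R%:E)%E.
Proof.
have mS A : measurable_fun A (fun t => (singular_factor d r t)%:E).
  by apply/measurable_EFinP; exact: measurable_singular_factor.
have mf A : measurable_fun A (fun t => (f t)%:E).
  by apply/measurable_EFinP; exact: measurable_norm_powR.
have f0 t : (0 <= (f t)%:E)%E by rewrite lee_fin powR_ge0.
have m1 (A : set R) : measurable A ->
    measurable_fun [set: measurableTypeR R] (fun t : R => (\1_A t)%:E : \bar R).
  by move=> mA; apply/measurable_EFinP; exact: measurable_indic.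
have mB := m1 _ (measurable_itv `]c - r, c + r[).
have mI := m1 _ (measurable_itv `[- r, r]).
pose g t := ((\1_(`]c - r, c + r[) t)%:E + ((f t)%:E * (\1_(`[(- r)%R, r]) t)%:E))%E.
apply: (@le_trans _ _ (\int[mu]_t g t)%E).
  apply: ge0_le_integral => //.
  - move=> t _; rewrite lee_fin mulr_ge0// (le_trans ler01)//.
    exact: singular_factor_ge1.
  - under eq_fun do rewrite EFinM.
    by apply: emeasurable_funM; [exact: mS|exact: mB].
  - by apply: emeasurable_funD; [exact: mB|apply: emeasurable_funM; [exact: mf|exact: mI]].
  move=> t _; rewrite /g -EFinM -EFinD lee_fin /singular_factor mulrDl mul1r lerD2l.
  case: ifPn => [tr|_]; last by rewrite mul0r mulr_ge0// powR_ge0.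
  rewrite ler_wpM2l ?powR_ge0// [in leRHS]indicE mem_set ?indicE ?lern1 ?leq_b1//.
  by rewrite /= in_itv/= -ler_norml.
rewrite ge0_integralD; [|exact: measurableT|by move=> t _; rewrite lee_fin|
  exact: mB|by move=> t _; rewrite mule_ge0// lee_fin|
  by apply: emeasurable_funM; [exact: mf|exact: mI]].
have -> : ((2 + 2 / (1 - d)) * r)%:E = ((2 * r)%:E + (2 * r / (1 - d))%R%:E)%E.
  by rewrite -EFinD; congr EFin; field; rewrite subr_eq0 gt_eqF.
apply: leeD.
  rewrite integral_indic// setIT.
  apply: (@le_trans _ _ (mu [set` `]c - r, c + r[])) => //.
  rewrite lebesgue_measure_itv/=; case: ifPn => _; last by rewrite lee_fin mulr_ge0// ltW.
  by rewrite -EFinD lee_fin; lra.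
apply: le_trans integral_powR_symmetric.
by rewrite [leRHS]integral_mkcond epatch_indic.
Qed.

End singular_integral.

(** * Lebesgue measure on tuples: product integrands, measurability, null sets, volume of balls *)

Section nlebesgue_theory.
Context {R : realType}.

Lemma measurable_prod_tnth n (f : 'I_n -> R -> R) D :
  (forall i, measurable_fun setT (f i)) ->
  measurable_fun D (fun x : rvec R n => \prod_(i < n) f i (tnth x i)).
Proof.
move=> mf; apply: measurable_funTS; apply: measurable_prod => i _.
by apply: (measurableT_comp (mf i)); exact: measurable_tnth.
Qed.

(** Induction on n: the measure in dimension n + 1 is a pushforward of a product measure, so Tonelli
    separates the first coordinate. In dimension 0 the measure is a Dirac mass and the product is
    empty. *)
Lemma integral_prod_tnth_le n (f : 'I_n -> R -> R) (K : R) : 0 <= K ->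
  (forall i t, 0 <= f i t) -> (forall i, measurable_fun setT (f i)) ->
  (forall i, (\int[@lebesgue_measure R]_t (f i t)%:E <= K%:E)%E) ->
  (\int[nlebesgue R n]_x (\prod_(i < n) f i (tnth x i))%:E <= (K ^+ n)%:E)%E.
Proof.
move=> K0; elim: n f => [|n IH] f f0 mf fK.
  rewrite integral_dirac//=; last first.
    by under eq_fun do rewrite big_ord0; exact: measurable_cst.
  by rewrite diracT mul1e big_ord0 expr0.
pose F (x : rvec R n.+1) := (\prod_(i < n.+1) f i (tnth x i))%:E.
pose G (x : rvec R n) := (\prod_(i < n) f (lift ord0 i) (tnth x i))%:E.
have G0 x : (0 <= G x)%E by rewrite lee_fin prodr_ge0.
have mF : measurable_fun setT F.
  by apply/measurable_EFinP; exact: (@measurable_prod_tnth n.+1 f setT mf).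
have mG : measurable_fun setT G.
  by apply/measurable_EFinP; exact: (@measurable_prod_tnth n (fun i => f (lift ord0 i)) setT (fun i => mf _)).
have mf0 : measurable_fun [set: measurableTypeR R] (fun t => (f ord0 t)%:E).
  by apply/measurable_EFinP; exact: mf.
have FE a x : F (cons_rvec (a, x)) = ((f ord0 a)%:E * G x)%E.
  rewrite /F big_ord_recl EFinM; congr (_ * (\prod_(i < n) _)%:E)%E.
  by apply/funext => i; rewrite tnthS.
have -> : (\int[nlebesgue R n.+1]_x F x =
    \int[@lebesgue_measure R \x nlebesgue R n]_x F (cons_rvec x))%E.
  rewrite -[LHS]/(\int[pushforward (@lebesgue_measure R \x nlebesgue R n)
    (@cons_rvec R n)]_x F x)%E.
  rewrite ge0_integral_pushforward//; first exact: measurable_cons_rvec.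
  by move=> x _; rewrite lee_fin prodr_ge0.
have mFc : measurable_fun [set: measurableTypeR R * rvec R n] (F \o @cons_rvec R n).
  by apply: (measurableT_comp mF); exact: measurable_cons_rvec.
have Fc0 (x : measurableTypeR R * rvec R n) : (0 <= (F \o @cons_rvec R n) x)%E by rewrite lee_fin prodr_ge0.
rewrite (fubini_tonelli1 _ mFc Fc0).
apply: (@le_trans _ _ (\int[@lebesgue_measure R]_a ((K ^+ n)%:E * (f ord0 a)%:E))%E).
  apply: ge0_le_integral => //.
  - by move=> a _; apply: integral_ge0 => x _; rewrite lee_fin prodr_ge0.
  - exact: (measurable_fun_fubini_tonelli_F (F \o @cons_rvec R n)).
  - exact: emeasurable_funM.
  move=> a _; rewrite /fubini_F; rewrite (eq_integral (fun x => (f ord0 a)%:E * G x)%E); last first.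
    by move=> x _; exact: FE.
  rewrite ge0_integralZl//; last by rewrite lee_fin.
  rewrite muleC lee_wpmul2r ?lee_fin//.
  exact: (IH (fun i => f (lift ord0 i))).
rewrite ge0_integralZl//; last 2 first.
  by move=> a _; rewrite lee_fin.
  by rewrite lee_fin exprn_ge0.
by rewrite exprSr EFinM lee_wpmul2l// lee_fin exprn_ge0.
Qed.

(** The index map g and the shift c cover |x|, |x'| and the distance to a centre at once. *)
Lemma measurable_sqrt_sum_tnth n m (g : 'I_m -> 'I_n) (c : 'I_m -> R)
    (N : rvec R n -> R) :
  (forall x, N x = Num.sqrt (\sum_(i < m) (tnth x (g i) - c i) ^+ 2)) ->
  measurable_fun setT N.
Proof.
move=> NE; have -> : N = (fun x => (\sum_(i < m) (tnth x (g i) - c i) ^+ 2) `^ 2^-1).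
  by apply/funext => x; rewrite NE powR12_sqrt// sumr_ge0// => i _; rewrite sqr_ge0.
apply: (measurableT_comp (measurable_powR 2^-1)); apply: measurable_sum => i.
apply: measurable_funX; apply: measurable_funB => //.
exact: measurable_tnth.
Qed.

Lemma measurable_enorm n : measurable_fun setT (@enorm R n).
Proof.
apply: (@measurable_sqrt_sum_tnth n n id (cst 0)) => x; congr Num.sqrt.
by apply: eq_bigr => i _; rewrite subr0.
Qed.

Lemma measurable_enorm_rprefix n :
  measurable_fun setT (fun x : rvec R n => enorm (rprefix x)).
Proof.
apply: (@measurable_sqrt_sum_tnth n n.-1 (widen_ord (leq_pred n)) (cst 0)) => x.
by congr Num.sqrt; apply: eq_bigr => i _; rewrite tnth_mktuple subr0.
Qed.

Lemma measurable_eball n (c : rvec R n) (r : R) : measurable (eball c r).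
Proof.
pose N (x : rvec R n) := enorm ([tuple tnth x i - tnth c i | i < n] : rvec R n).
have mN : measurable_fun setT N.
  apply: (@measurable_sqrt_sum_tnth n n id (tnth c)) => x; congr Num.sqrt.
  by apply: eq_bigr => i _; rewrite tnth_mktuple.
have -> : eball c r = setT `&` N @^-1` `]-oo, r[.
  by rewrite setTI; apply/seteqP; split => x; rewrite /= in_itv.
exact: mN.
Qed.

Lemma rlastE n (x : rvec R n.+1) : rlast x = tnth x ord_max.
Proof. by rewrite /rlast (tnth_nth 0) -nth_last size_tuple; case/tupleP: x. Qed.

Lemma measurable_rlast n : measurable_fun setT (@rlast R n.+1).
Proof.
rewrite (_ : @rlast R n.+1 = (fun x : rvec R n.+1 => tnth x ord_max)).
  exact: measurable_tnth.
by apply/funext => x; exact: rlastE.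
Qed.

Lemma measurable_aniso_weight n (a b c : R) :
  measurable_fun setT (@aniso_weight R n.+1 a b c).
Proof.
apply: measurable_funM; first apply: measurable_funM.
- by apply: (measurableT_comp (measurable_powR a)); exact: measurable_enorm_rprefix.
- by apply: (measurableT_comp (measurable_powR b)); exact: measurable_enorm.
- apply: (measurableT_comp (measurable_powR c)); apply: measurableT_comp => //.
  exact: measurable_rlast.
Qed.

Lemma sqr_enorm n (x : rvec R n) : enorm x ^+ 2 = \sum_(i < n) tnth x i ^+ 2.
Proof. by rewrite sqr_sqrtr// sumr_ge0// => i _; rewrite sqr_ge0. Qed.

Lemma enorm_ge0 n (x : rvec R n) : 0 <= enorm x.
Proof. exact: sqrtr_ge0. Qed.

Lemma norm_tnth_le_enorm n (x : rvec R n) i : `|tnth x i| <= enorm x.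
Proof.
rewrite -(@ler_pXn2r _ 2) ?nnegrE ?enorm_ge0// sqr_enorm real_normK ?num_real//.
by rewrite (bigD1 i)//= lerDl sumr_ge0// => j _; rewrite sqr_ge0.
Qed.

Lemma sqr_enorm_decomp n (x : rvec R n.+1) :
  enorm x ^+ 2 = enorm (rprefix x) ^+ 2 + `|rlast x| ^+ 2.
Proof.
rewrite !sqr_enorm big_ord_recr/= rlastE real_normK ?num_real//; congr (_ + _).
apply: eq_bigr => i _; rewrite tnth_mktuple; congr (tnth _ _ ^+ 2).
exact: val_inj.
Qed.

(** This rests on 2 y^2 + 2 (x - y)^2 - x^2 = (x - 2 y)^2. *)
Lemma sqr_le_double_sum (x y z : R) : (x - y) ^+ 2 <= z ^+ 2 -> x ^+ 2 <= 2 * y ^+ 2 + 2 * z ^+ 2.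
Proof. by have := sqr_ge0 (x - 2 * y); nra. Qed.

(* The factor 2 of the weak triangle inequality replaces Cauchy-Schwarz. *)
Lemma sqr_enorm_le2 n (x y z : rvec R n) :
  (forall i, `|tnth x i - tnth y i| <= `|tnth z i|) ->
  enorm x ^+ 2 <= 2 * enorm y ^+ 2 + 2 * enorm z ^+ 2.
Proof.
move=> xyz; rewrite !sqr_enorm !mulr_sumr -big_split/=; apply: ler_sum => i _.
apply: sqr_le_double_sum; rewrite -[leLHS]real_normK ?num_real//.
by rewrite -[leRHS]real_normK ?num_real// ler_pXn2r ?nnegrE.
Qed.

(** Each hyperplane is a box with one side {0} and the other sides the whole line; its measure
    vanishes by the convention that 0 times infinity is 0. *)
Lemma nlebesgue_coordinate_hyperplanes n :
  (nlebesgue R n).-negligible [set x | exists i, tnth x i = 0].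
Proof.
have mA (i j : 'I_n) : measurable (if j == i then [set (0 : R)] else setT).
  by case: ifP.
pose Z i := [set x : rvec R n | forall j, (if j == i then [set (0 : R)] else setT) (tnth x j)].
have ZE i : Z i = (fun x : rvec R n => tnth x i) @^-1` [set 0].
  apply/seteqP; split => x; rewrite /Z/=; first by move=> /(_ i); rewrite eqxx.
  by move=> x0 j; case: eqP => // ->.
have mZ i : measurable (Z i).
  by rewrite ZE -[X in measurable X]setTI; exact: measurable_tnth.
have Z0 i : nlebesgue R n (Z i) = 0%E.
  rewrite (@nlebesgue_box R n (fun j => if j == i then [set (0 : R)] else setT))//.
  by rewrite (bigD1 i)//= eqxx lebesgue_measure_set1 mul0e.
suff : (nlebesgue R n).-negligible (\big[setU/set0]_(i < n) Z i).
  apply: negligibleS.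
  move=> x [i xi]; rewrite -bigcup_seq; exists i; first by rewrite /= mem_index_enum.
  by rewrite ZE.
apply: (big_ind (negligible (nlebesgue R n))).
- exact: negligible_set0.
- by move=> A B; exact: negligibleU.
- by move=> i _; apply/negligibleP; [exact: mZ|exact: Z0].
Qed.

(** The ball contains the open cube of half-side e = r / (n + 1) around c, since (n + 1) e^2 = r^2 /
    (n + 1) <= r^2. *)
Lemma nlebesgue_eball_ge n (c : rvec R n.+1) (r : R) : 0 < r ->
  (((2 * r / n.+1%:R) ^+ n.+1)%:E <= nlebesgue R n.+1 (eball c r))%E.
Proof.
move=> r0; have n0 : 0 < n.+1%:R :> R by rewrite ltr0n.
pose e := r / n.+1%:R; have e0 : 0 < e by exact: divr_gt0.
pose A i : set R := [set` `]tnth c i - e, tnth c i + e[].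
have mA i : measurable (A i) by exact: measurable_itv.
have -> : ((2 * r / n.+1%:R) ^+ n.+1)%:E = nlebesgue R n.+1 [set x | forall i, A i (tnth x i)].
  rewrite (@nlebesgue_box R n.+1 A)// (eq_bigr (fun=> (2 * r / n.+1%:R)%:E)); last first.
    move=> i _; rewrite /A lebesgue_measure_itv/= lte_fin ifT; last by lra.
    by rewrite -EFinD; congr EFin; rewrite /e; field.
  by rewrite prodEFin prodr_const card_ord.
apply: le_measure; rewrite ?inE.
- rewrite [X in measurable X](_ : _ =
      \bigcap_(i in [set: 'I_n.+1]) ((fun x : rvec R n.+1 => tnth x i) @^-1` A i)).
    apply: fin_bigcap_measurable => // i _; rewrite -[X in measurable X]setTI.
    by apply: measurable_tnth => //; exact: mA.
  by apply/seteqP; split => x /= h i; [move=> _|]; exact: h.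
- exact: measurable_eball.
move=> x /= Ax; rewrite /eball/=.
rewrite -(@ltr_pXn2r _ 2) ?nnegrE ?enorm_ge0 ?(ltW r0)// sqr_enorm.
apply: (@lt_le_trans _ _ (\sum_(i < n.+1) e ^+ 2)).
  apply: ltr_sum; first by apply/hasP; exists ord0; rewrite ?mem_index_enum.
  move=> i _; rewrite tnth_mktuple; have := Ax i; rewrite /A/= in_itv/= => /andP[h1 h2].
  rewrite -[ltLHS]real_normK ?num_real// ltr_pXn2r ?nnegrE ?(ltW e0)//.
  by rewrite ltr_norml; apply/andP; split; lra.
rewrite sumr_const card_ord -[leLHS]mulr_natr.
have -> : e ^+ 2 * n.+1%:R = r ^+ 2 * n.+1%:R^-1 by rewrite /e; field.
by rewrite ler_piMr ?sqr_ge0// invf_le1// ler1n.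
Qed.

End nlebesgue_theory.

(** * Averages of the weight over balls and duality of the exponents *)

Section aniso_weight_averages.
Context {R : realType}.

(** The quantity M of the opening comment. The maxima with r keep it positive for every centre, so
    that it can be cancelled. *)
Definition aniso_scale {n} (a b c : R) (y : rvec R n) (r : R) : R :=
  Num.max (enorm (rprefix y)) r `^ a * Num.max (enorm y) r `^ b *
  Num.max `|rlast y| r `^ c.

Lemma aniso_scale_gt0 n (a b c : R) (y : rvec R n) (r : R) : 0 < r -> 0 < aniso_scale a b c y r.
Proof.
by move=> r0; rewrite /aniso_scale !mulr_gt0// powR_gt0// lt_max r0 orbT.
Qed.

Lemma aniso_weight_ge0 n (a b c : R) (x : rvec R n) : 0 <= aniso_weight a b c x.
Proof. by rewrite /aniso_weight !mulr_ge0// powR_ge0. Qed.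

(** In dimension at least 2 the vector x' has a coordinate, which bounds |x'| away from 0. *)
Lemma aniso_weight_gt0 n (a b c : R) (x : rvec R n.+2) :
  (forall i, tnth x i != 0) -> 0 < aniso_weight a b c x.
Proof.
move=> x0; rewrite /aniso_weight !mulr_gt0// powR_gt0//.
- apply: lt_le_trans (norm_tnth_le_enorm _ (rprefix x) ord0).
  by rewrite tnth_mktuple normr_gt0.
- by apply: lt_le_trans (norm_tnth_le_enorm _ x ord0); rewrite normr_gt0.
- by rewrite rlastE normr_gt0.
Qed.

Lemma eball_norm_tnth n (y x : rvec R n) (r : R) : eball y r x ->
  forall i, `|tnth x i - tnth y i| < r.
Proof.
move=> yrx i; have := norm_tnth_le_enorm _ [tuple tnth x i - tnth y i | i < n] i.
by rewrite tnth_mktuple => /le_lt_trans; apply.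
Qed.

(** For z = x - y, both |z'| and |z_n| are at most |z| < r; the weak triangle inequality then
    applies to each of the three norms. *)
Lemma eball_comparable n (y x : rvec R n.+1) (r : R) : eball y r x ->
  [/\ enorm (rprefix x) ^+ 2 <= 2 * enorm (rprefix y) ^+ 2 + 2 * r ^+ 2,
      enorm x ^+ 2 <= 2 * enorm y ^+ 2 + 2 * r ^+ 2 &
      `|rlast x| ^+ 2 <= 2 * `|rlast y| ^+ 2 + 2 * r ^+ 2].
Proof.
move=> yrx; pose z : rvec R n.+1 := [tuple tnth x i - tnth y i | i < n.+1].
have zr : enorm z ^+ 2 <= r ^+ 2.
  by rewrite ler_pXn2r ?nnegrE ?enorm_ge0 ?ltW// (le_lt_trans _ yrx)// enorm_ge0.
have le_r (u v : R) : v <= r ^+ 2 -> u + 2 * v <= u + 2 * r ^+ 2.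
  by move=> vr; rewrite lerD2l ler_pM2l.
have := sqr_enorm_decomp _ z => zE.
have zp : enorm (rprefix z) ^+ 2 <= r ^+ 2 by rewrite (le_trans _ zr)// zE lerDl sqr_ge0.
have zl : `|rlast z| ^+ 2 <= r ^+ 2 by rewrite (le_trans _ zr)// zE lerDr sqr_ge0.
split.
- apply: le_trans (le_r _ _ zp); apply: sqr_enorm_le2 => i.
  by rewrite !tnth_mktuple.
- apply: le_trans (le_r _ _ zr); apply: sqr_enorm_le2 => i.
  by rewrite !tnth_mktuple.
- apply: le_trans (le_r _ _ zl); rewrite !real_normK ?num_real//.
  by apply: sqr_le_double_sum; rewrite !rlastE tnth_mktuple.
Qed.

Lemma eball_sym n (y x : rvec R n) (r : R) : eball y r x -> eball x r y.
Proof.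
rewrite /eball/= /enorm; congr (Num.sqrt _ < _); apply: eq_bigr => i _.
by rewrite !tnth_mktuple -sqrrN opprB.
Qed.

Lemma aniso_weight_le m (a b c : R) :
  - m.+1%:R < a -> -1 < c -> - (m.+1%:R + 1) < a + b + c ->
  exists K d : R, [/\ 0 < K, d < 1 &
    forall (y x : rvec R m.+2) (r : R), 0 < r -> (forall i, tnth x i != 0) -> eball y r x ->
    aniso_weight a b c x <= K * aniso_scale a b c y r *
      \prod_(i < m.+2) singular_factor d r (tnth x i)].
Proof.
move=> am c1 abc; have [K [d [K0 d1 Kd]]] := triple_powR_le m a b c am c1 abc.
exists K, d; split=> // y x r r0 x0 yrx.
have [xp xf xl] := eball_comparable _ _ _ _ yrx.
have [yp yf yl] := eball_comparable _ _ _ _ (eball_sym _ _ _ _ yrx).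
have prefix_le (z : rvec R m.+2) : enorm (rprefix z) <= enorm z.
  by rewrite -(@ler_pXn2r _ 2) ?nnegrE ?enorm_ge0// [leRHS]sqr_enorm_decomp lerDl sqr_ge0.
have last_le (z : rvec R m.+2) : `|rlast z| <= enorm z.
  by rewrite rlastE norm_tnth_le_enorm.
rewrite big_ord_recr/= /aniso_weight /aniso_scale.
have -> : \prod_(i < m.+1) singular_factor d r (tnth x (widen_ord (leqnSn m.+1) i)) =
  \prod_(i < m.+1) singular_factor d r (tnth (rprefix x) i).
  apply: eq_bigr => i _; rewrite tnth_mktuple; congr (singular_factor _ _ (tnth _ _)).
  exact: val_inj.
have p0 : 0 < enorm (rprefix x).
  apply: lt_le_trans (norm_tnth_le_enorm _ (rprefix x) ord0).
  by rewrite tnth_mktuple normr_gt0.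
apply: Kd; rewrite ?enorm_ge0 ?rlastE//.
- by move=> i; rewrite tnth_mktuple.
- exact: norm_tnth_le_enorm.
- by rewrite -rlastE.
- by rewrite -rlastE.
- by rewrite -!rlastE.
- by rewrite -!rlastE.
Qed.

(** The ball lies in the cube of half-side r around y. With the indicators of its sides, the
    majorant is a product of functions of one variable, each of integral at most L r. *)
Lemma integral_aniso_weight_le m (a b c : R) :
  - m.+1%:R < a -> -1 < c -> - (m.+1%:R + 1) < a + b + c ->
  exists2 K : R, 0 < K & forall (y : rvec R m.+2) (r : R), 0 < r ->
    (\int[nlebesgue R m.+2]_(x in eball y r) (aniso_weight a b c x)%:E <=
     (K * aniso_scale a b c y r * r ^+ m.+2)%:E)%E.
Proof.
move=> am c1 abc; have [K [d [K0 d1 Kd]]] := aniso_weight_le m a b c am c1 abc.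
have d10 : 0 < 1 - d by rewrite subr_gt0.
pose L : R := 2 + 2 / (1 - d).
have L0 : 0 < L by rewrite addr_gt0// divr_gt0.
exists (K * L ^+ m.+2); first by rewrite mulr_gt0// exprn_gt0.
move=> y r r0; set M := aniso_scale a b c y r.
have KM0 : 0 <= K * M by rewrite mulr_ge0 ?(ltW K0)// ltW// aniso_scale_gt0.
pose f (i : 'I_m.+2) t := singular_factor d r t * \1_(`]tnth y i - r, tnth y i + r[) t.
have sf0 t : 0 <= singular_factor d r t by rewrite (le_trans ler01)// singular_factor_ge1.
have f0 i t : 0 <= f i t by rewrite mulr_ge0.
have mf i : measurable_fun setT (f i).
  apply: measurable_funM; first exact: measurable_singular_factor.
  exact: measurable_indic.
have mF D : measurable_fun D (fun x : rvec R m.+2 => (\prod_(i < m.+2) f i (tnth x i))%:E).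
  by apply/measurable_EFinP; exact: (@measurable_prod_tnth R m.+2 f D mf).
have mW D : measurable_fun D (fun x : rvec R m.+2 => (aniso_weight a b c x)%:E).
  by apply/measurable_EFinP; apply: measurable_funTS; exact: measurable_aniso_weight.
have F0 x : (0 <= (\prod_(i < m.+2) f i (tnth x i))%:E)%E by rewrite lee_fin prodr_ge0.
have mB : measurable (eball y r) by exact: measurable_eball.
apply: (@le_trans _ _ (\int[nlebesgue R m.+2]_(x in eball y r)
    ((K * M)%:E * (\prod_(i < m.+2) f i (tnth x i))%:E))%E).
  apply: ae_ge0_le_integral => //.
  - by move=> x _; rewrite lee_fin aniso_weight_ge0.
  - by move=> x _; rewrite mule_ge0.
  - exact: emeasurable_funM.
  (* The pointwise bound is available only off the coordinate hyperplanes, hence the comparison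
     almost everywhere. *)
  apply: negligibleS (nlebesgue_coordinate_hyperplanes m.+2) => x /= xN.
  apply: contrapT => /forallNP x0; apply: xN => yrx.
  rewrite -EFinM lee_fin (_ : \prod_(i < m.+2) f i (tnth x i) =
    \prod_(i < m.+2) singular_factor d r (tnth x i)).
    by apply: Kd => // i; apply/eqP; exact: x0.
  apply: eq_bigr => i _; rewrite /f indicE mem_set ?mulr1//=.
  have := eball_norm_tnth _ _ _ _ yrx i; rewrite ltr_norml in_itv/= => /andP[h1 h2].
  by apply/andP; split; lra.
rewrite ge0_integralZl; [|exact: mB|exact: mF|by move=> x _; exact: F0|by rewrite lee_fin].
have -> : K * L ^+ m.+2 * M * r ^+ m.+2 = K * M * (L * r) ^+ m.+2.
  by rewrite exprMn; ring.
rewrite [leRHS]EFinM lee_wpmul2l ?lee_fin//.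
apply: (@le_trans _ _ (\int[nlebesgue R m.+2]_x (\prod_(i < m.+2) f i (tnth x i))%:E)%E).
  exact: ge0_subset_integral.
apply: integral_prod_tnth_le => //; first by rewrite mulr_ge0 ?ltW.
by move=> i; exact: integral_singular_factor.
Qed.

Lemma average_aniso_weight_le m (a b c : R) :
  - m.+1%:R < a -> -1 < c -> - (m.+1%:R + 1) < a + b + c ->
  exists2 K : R, 0 < K & forall (y : rvec R m.+2) (r : R), 0 < r ->
    (average (eball y r) (aniso_weight a b c) <= (K * aniso_scale a b c y r)%:E)%E.
Proof.
move=> am c1 abc; have [K K0 hK] := integral_aniso_weight_le m a b c am c1 abc.
(* The ball has volume at least k r^(m + 2), by the inscribed cube. *)
pose k : R := (2 / m.+2%:R) ^+ m.+2.
have k0 : 0 < k by rewrite exprn_gt0// divr_gt0// ltr0n.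
exists (k^-1 * K); first by rewrite mulr_gt0// invr_gt0.
move=> y r r0; have rn0 : 0 < r ^+ m.+2 by exact: exprn_gt0.
have vol : ((k * r ^+ m.+2)%:E <= nlebesgue R m.+2 (eball y r))%E.
  rewrite /k -exprMn (_ : 2 / m.+2%:R * r = 2 * r / m.+2%:R); last by ring.
  exact: nlebesgue_eball_ge.
apply: (@le_trans _ _ (((k * r ^+ m.+2)^-1)%:E *
    (K * aniso_scale a b c y r * r ^+ m.+2)%:E)%E).
  apply: lee_pmul => //.
  - by rewrite inve_ge0.
  - by apply: integral_ge0 => x _; rewrite lee_fin aniso_weight_ge0.
  - have -> : ((k * r ^+ m.+2)^-1)%:E = ((k * r ^+ m.+2)%:E)^-1%E.
      by rewrite inver gt_eqF// mulr_gt0.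
    by rewrite lee_pV2 ?inE// lee_fin mulr_ge0 ?ltW.
  - exact: hK.
rewrite -EFinM lee_fin le_eqVlt; apply/orP; left; apply/eqP.
by field; rewrite !gt_eqF.
Qed.

Lemma aniso_weight_powR n (a b c q : R) (x : rvec R n) :
  aniso_weight a b c x `^ q = aniso_weight (a * q) (b * q) (c * q) x.
Proof. by rewrite /aniso_weight !powRM ?mulr_ge0 ?powR_ge0// -!powRrM. Qed.

Lemma aniso_scale_powR n (a b c q : R) (y : rvec R n) (r : R) : 0 < r ->
  aniso_scale a b c y r `^ q = aniso_scale (a * q) (b * q) (c * q) y r.
Proof. by move=> r0; rewrite /aniso_scale !powRM ?mulr_ge0 ?powR_ge0// -!powRrM. Qed.

Lemma aniso_weight_is_weight m (a b c : R) :
  - m.+1%:R < a -> -1 < c -> - (m.+1%:R + 1) < a + b + c ->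
  is_weight (@aniso_weight R m.+2 a b c).
Proof.
move=> am c1 abc; split.
- by move=> x; exact: aniso_weight_ge0.
- apply: negligibleS (nlebesgue_coordinate_hyperplanes m.+2) => x /= xN.
  apply: contrapT => /forallNP x0; apply: xN; apply: aniso_weight_gt0 => i.
  by apply/eqP; exact: x0.
move=> y r r0; apply/integrableP; split.
  by apply/measurable_EFinP; apply: measurable_funTS; exact: measurable_aniso_weight.
have [K K0 /(_ y r r0) hK] := integral_aniso_weight_le m a b c am c1 abc.
under eq_integral do rewrite /= ger0_norm ?aniso_weight_ge0//.
exact: le_lt_trans hK (ltry _).
Qed.

(** In the first set the bound on a + b + c comes from adding the other three conditions; in the
    second it is one of the conditions. *)
Lemma setAB_admissible m (a b c : R) : (setA m.+2 `|` setB m.+2) (a, b, c) ->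
  [/\ - m.+1%:R < a, -1 < c & - (m.+1%:R + 1) < a + b + c].
Proof.
have mE : m.+2%:R = m.+1%:R + 1 :> R by rewrite -natr1.
by move=> [] []; rewrite mE; [move=> ? ? ?|move=> ? ? ? ?]; split; lra.
Qed.

(** Division by - (p - 1) reverses the inequalities and carries C_p into A and D_p into B. *)
Lemma setCDp_admissible m (p a b c : R) : 1 < p ->
  (setCp m.+2 p `|` setDp m.+2 p) (a, b, c) ->
  (setA m.+2 `|` setB m.+2)
    (a * - (p - 1)^-1, b * - (p - 1)^-1, c * - (p - 1)^-1).
Proof.
move=> p1; have q0 : 0 < p - 1 by rewrite subr_gt0.
have lt_q (t s : R) : t < s * (p - 1) -> - s < t * - (p - 1)^-1.
  by move=> ts; rewrite mulrN ltrN2 ltr_pdivrMr.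
case=> [[h1 h2 h3]|[h1 h2 h3 h4]]; [left|right].
  split; [exact: lt_q|by rewrite mulr_le0// oppr_le0 invr_ge0 ltW|].
  by apply: lt_q; rewrite mul1r.
split; [exact: lt_q|by rewrite pmulr_rlt0// oppr_lt0 invr_gt0| |].
  by apply: lt_q; rewrite mul1r.
by rewrite -!mulrDl; exact: lt_q.
Qed.

End aniso_weight_averages.

(** * The A_p inequality from the bounds on the averages of the weight and of its dual *)

Theorem theorem2p3 (R : realType) (n : nat) (p : R) (t1 t2 t3 : R)
    (n_ge2 : (2 <= n)%N) (p_gt1 : 1 < p)
    (ht : ((setA n `|` setB n) `&` (setCp n p `|` setDp n p)) (t1, t2, t3)) :
  Ap_weight p (@aniso_weight R n t1 t2 t3).
Proof.
case: n n_ge2 ht => [//|[//|m]] _ [hAB /(setCDp_admissible _ _ _ _ _ p_gt1) hAB'].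
have [am c1 abc] := setAB_admissible _ _ _ _ hAB.
have [am' c1' abc'] := setAB_admissible _ _ _ _ hAB'.
split; first exact: aniso_weight_is_weight.
have [K K0 hK] := average_aniso_weight_le _ _ _ _ am c1 abc.
have [K' K'0 hK'] := average_aniso_weight_le _ _ _ _ am' c1' abc'.
have q0 : 0 < p - 1 by rewrite subr_gt0.
(* The dual average enters with the power p - 1, and so does its constant K'. *)
exists (K * K' `^ (p - 1)); split; first by rewrite mulr_gt0// powR_gt0.
move=> y r r0; set q := - (p - 1)^-1.
have -> : (fun x => aniso_weight t1 t2 t3 x `^ q) =
    @aniso_weight R m.+2 (t1 * q) (t2 * q) (t3 * q).
  by apply/funext => x; exact: aniso_weight_powR.
have M0 : 0 < aniso_scale t1 t2 t3 y r by exact: aniso_scale_gt0.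
have avg_ge0 a b c : (0 <= average (eball y r) (@aniso_weight R m.+2 a b c))%E.
  rewrite mule_ge0 ?inve_ge0//.
  by apply: integral_ge0 => x _; rewrite lee_fin aniso_weight_ge0.
apply: (@le_trans _ _ ((K * aniso_scale t1 t2 t3 y r)%:E *
    poweR ((K' * aniso_scale (t1 * q) (t2 * q) (t3 * q) y r)%:E) (p - 1))%E).
  apply: lee_pmul; rewrite ?poweR_ge0//; first exact: hK.
  apply: (gt0_ler_poweR (ltW q0)).
  - by rewrite in_itv/= avg_ge0 leey.
  - by rewrite in_itv/= lee_fin leey andbT mulr_ge0// ltW// aniso_scale_gt0.
  - exact: hK'.
(* The dual scale is M^q with q (p - 1) = -1, so its power p - 1 is the inverse of M and cancels the
   first scale. *)
rewrite poweR_EFin -EFinM lee_fin -aniso_scale_powR// powRM ?powR_ge0 ?(ltW K'0)//.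
rewrite -powRrM /q mulNr mulVf ?gt_eqF// powR_inv1 ?(ltW M0)//.
rewrite le_eqVlt; apply/orP; left; apply/eqP.
by field; rewrite gt_eqF.
Qed.
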